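(* Let $V$ be a finite dimensional real vector space and let $A \leq \mathrm{Aff}(V)$ be a Zariski-closed subgroup acting transitively on $V$. Let $\Gamma$ be a finitely generated torsionfree nilpotent group which is isomorphic to an affine crystallographic group of type $A$, and let $\Delta$ be an effective finite extension of $\Gamma$ with associated abstract kernel $\beta: F=\Delta/\Gamma \to \mathrm{Out}(\Gamma)$. Then $\Delta$ may be realized as an affine crystallographic group of type $A$ (i.e. is isomorphic to one) if and only if the kernel $\beta$ has a fixed point in $\mathcal{D}_c(\Gamma, A)$.
   Context: A subgroup of $\mathrm{Aff}(V) = V\rtimes \mathrm{GL}(V)$ is an affine crystallographic group if it acts properly discontinuously on $V$ with compact quotient; it is of type $A$ if it is contained in $A$. $\mathrm{Hom}_c(\Gamma,A)$ is the set of injective homomorphisms $\rho: \Gamma \to A$ such that $\rho(\Gamma)$ is an affine crystallographic group, and $\mathcal{D}_c(\Gamma,A) = \mathrm{Hom}_c(\Gamma,A)/A$ is the quotient by the conjugation action of $A$. $\mathrm{Aut}(\Gamma)$ acts on $\mathrm{Hom}_c(\Gamma,A)$ by $\rho \mapsto \rho\circ\phi^{-1}$, inducing an action of $\mathrm{Out}(\Gamma)$ on $\mathcal{D}_c(\Gamma,A)$. A fixed point for $\beta$ is a point fixed by $\beta(F)\leq \mathrm{Out}(\Gamma)$. An effective finite extension of $\Gamma$ is a group $\Delta$ containing $\Gamma$ as a normal subgroup of finite index such that the homomorphism $\beta: \Delta/\Gamma \to \mathrm{Out}(\Gamma)$ induced by conjugation is injective. *)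

(* Defs.v *)
From HB Require Import structures.
From mathcomp Require Import all_boot all_order all_algebra.
From mathcomp Require mpoly.
From mathcomp Require Import all_classical all_reals topology.

Set Implicit Arguments.
Unset Strict Implicit.
Unset Printing Implicit Defensive.

Import GRing.Theory numFieldTopology.Exports.

Local Open Scope classical_set_scope.
Local Open Scope group_scope.

Section Groups.
Context {G : groupType}.
Implicit Types (N X : set G).

Definition is_subgroup (H : set G) : Prop :=
  [/\ H 1, (forall x y, H x -> H y -> H (x * y)) & (forall x, H x -> H x^-1)].

Definition is_normal_subgroup N : Prop :=
  is_subgroup N /\ (forall x g, N x -> N (x ^ g)).

Definition generated X : set G := smallest is_subgroup X.

Definition lcoset N (g : G) : set G := [set g * x | x in N].

(* The elements of G / N, for N normal: left cosets, as sets. *)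
Definition quotient_group N : set (set G) := range (lcoset N).

Fixpoint lower_central_series (k : nat) : set G :=
  if k is k'.+1 then
    generated [set [~ x, y] | x in lower_central_series k' & y in [set: G]]
  else [set: G].

End Groups.

Definition finitely_generated (G : groupType) : Prop :=
  exists2 X : set G, finite_set X & generated X = [set: G].

Definition torsionfree (G : groupType) : Prop :=
  forall (x : G) (k : nat), (0 < k)%N -> x ^+ k = 1 -> x = 1.

Definition is_nilpotent (G : groupType) : Prop :=
  exists k, @lower_central_series G k = [set 1].

Section Automorphisms.
Variable G : groupType.

Record Aut := MkAut {
  aut_fun :> G -> G;
  aut_inv : G -> G;
  aut_funK : cancel aut_fun aut_inv;
  aut_invK : cancel aut_inv aut_fun;
  aut_funM : {morph aut_fun : x y / x * y}
}.

HB.instance Definition _ := gen_eqMixin Aut.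
HB.instance Definition _ := gen_choiceMixin Aut.

Lemma Aut_ext (f g : Aut) : aut_fun f = aut_fun g -> f = g.
Proof.
case: f g => f f' fK f'K fM [g g' gK g'K gM] /= efg.
subst g; have efg' : f' = g'.
  by apply/funext => x; rewrite -{1}(g'K x) fK.
by subst g'; congr MkAut; exact: Prop_irrelevance.
Qed.

Definition aut_one : Aut :=
  @MkAut idfun idfun (fun=> erefl) (fun=> erefl) (fun _ _ => erefl).

Definition aut_mul (f g : Aut) : Aut.
Proof.
exists (f \o g) (aut_inv g \o aut_inv f).
- exact: can_comp (aut_funK f) (aut_funK g).
- exact: can_comp (aut_invK g) (aut_invK f).
- by move=> x y /=; rewrite !aut_funM.
Defined.

Definition aut_invg (f : Aut) : Aut.
Proof.
exists (aut_inv f) (aut_fun f).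
- exact: aut_invK.
- exact: aut_funK.
- by move=> x y; apply: (can_inj (aut_funK f)); rewrite aut_funM !aut_invK.
Defined.

Lemma aut_mulA : associative aut_mul.
Proof. by move=> f g h; exact: Aut_ext. Qed.
Lemma aut_mul1 : left_id aut_one aut_mul.
Proof. by move=> f; exact: Aut_ext. Qed.
Lemma aut_mulr1 : right_id aut_one aut_mul.
Proof. by move=> f; exact: Aut_ext. Qed.
Lemma aut_mulV : left_inverse aut_one aut_invg aut_mul.
Proof. by move=> f; apply/Aut_ext/funext => x /=; rewrite aut_funK. Qed.
Lemma aut_mulrV : right_inverse aut_one aut_invg aut_mul.
Proof. by move=> f; apply/Aut_ext/funext => x /=; rewrite aut_invK. Qed.

HB.instance Definition _ :=
  isGroup.Build Aut aut_mulA aut_mul1 aut_mulr1 aut_mulV aut_mulrV.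

Definition Inn : set Aut :=
  [set phi | exists g : G, forall x, phi x = g * x * g^-1].

Definition Out : set (set Aut) := quotient_group Inn.

End Automorphisms.

(* Gamma is regarded as a subgroup of Delta through i, see
   effective_finite_extension. *)
Section Extensions.
Variables (Gamma Delta : groupType) (i : {multiplicative Gamma -> Delta}).

(* The map beta : Delta / Gamma -> Out Gamma induced by conjugation, on cosets
   represented as sets: the image of the coset f consists of the automorphisms
   of Gamma induced by conjugation by the elements of f; this is a coset of
   Inn Gamma, see abstract_kernel_lcoset. *)
Definition abstract_kernel (f : set Delta) : set (Aut Gamma) :=
  [set phi | exists2 d, f d & forall x, i (phi x) = d * i x * d^-1].

Definition effective_finite_extension : Prop :=
  [/\ injective i, is_normal_subgroup (range i),
      finite_set (quotient_group (range i)) &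
      set_inj (quotient_group (range i)) abstract_kernel].

Lemma abstract_kernel_lcoset (d : Delta) (phi : Aut Gamma) :
    injective i -> (forall x, i (phi x) = d * i x * d^-1) ->
  abstract_kernel (lcoset (range i) d) = lcoset (@Inn Gamma) phi.
Proof.
move=> iI hphi.
have i1 : i 1 = 1 by apply: (mulgI (i 1)); rewrite -gmulfM !mulg1.
have iV x : i x^-1 = (i x)^-1.
  by apply: (mulgI (i x)); rewrite -gmulfM !mulgV.
apply/seteqP; split=> psi.
- move=> [_ [_ [g _ <-] <-] hpsi]; exists (phi^-1 * psi); last first.
    by rewrite mulVKg.
  exists g => x; apply: (can_inj (aut_funK phi)); apply: iI.
  rewrite -[phi _]/((phi * (phi^-1 * psi)) x) mulVKg hpsi hphi !gmulfM iV.
  by rewrite invgM !mulgA.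
- move=> [eta [g hg] <-]; exists (d * i g).
    by exists (i g) => //; exists g.
  move=> x; rewrite -[(phi * eta) x]/(phi (eta x)) hg hphi !gmulfM iV.
  by rewrite invgM !mulgA.
Qed.

End Extensions.

Section Affine.
Variables (R : realType) (n : nat).
Local Notation V := ('cV[R]_n).

(* The pair (g, v) stands for the map x |-> g x + v. *)
Record Aff := MkAff {
  aff_pair :> 'M[R]_n * V;
  aff_unit : aff_pair.1 \in unitmx
}.

HB.instance Definition _ := [isSub for aff_pair].
HB.instance Definition _ := [Choice of Aff by <:].

Implicit Types (a b : Aff).

Definition aff_lin a : 'M[R]_n := a.1.
Definition aff_trans a : V := a.2.

Definition aff_act a (v : V) : V := (aff_lin a *m v + aff_trans a)%R.

Definition aff_one : Aff := @MkAff (1%:M, 0)%R (unitmx1 _ _).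

Definition aff_mul a b : Aff.
Proof.
exists (aff_lin a *m aff_lin b, aff_lin a *m aff_trans b + aff_trans a)%R.
by rewrite unitmx_mul !aff_unit.
Defined.

Definition aff_inv a : Aff.
Proof.
exists (invmx (aff_lin a), - (invmx (aff_lin a) *m aff_trans a))%R.
by rewrite unitmx_inv aff_unit.
Defined.

Lemma aff_mulA : associative aff_mul.
Proof.
move=> a b c; apply: val_inj; congr (_, _) => /=; first exact: mulmxA.
by rewrite /aff_lin /aff_trans /= mulmxDr mulmxA addrA.
Qed.
Lemma aff_mul1 : left_id aff_one aff_mul.
Proof.
move=> [[g v] gu]; apply: val_inj.
by rewrite /= /aff_lin /aff_trans /= !mul1mx addr0.
Qed.
Lemma aff_mulr1 : right_id aff_one aff_mul.
Proof.
move=> [[g v] gu]; apply: val_inj.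
by rewrite /= /aff_lin /aff_trans /= mulmx1 mulmx0 add0r.
Qed.
Lemma aff_mulV : left_inverse aff_one aff_inv aff_mul.
Proof.
move=> [[g v] gu]; apply: val_inj.
by rewrite /= /aff_lin /aff_trans /= mulVmx ?subrr.
Qed.
Lemma aff_mulrV : right_inverse aff_one aff_inv aff_mul.
Proof.
move=> [[g v] gu]; apply: val_inj.
by rewrite /= /aff_lin /aff_trans /= mulmxN mulmxA mulmxV // mul1mx addNr.
Qed.

HB.instance Definition _ :=
  isGroup.Build Aff aff_mulA aff_mul1 aff_mulr1 aff_mulV aff_mulrV.

Lemma aff_act1 v : aff_act 1 v = v.
Proof. by rewrite /aff_act mul1mx addr0. Qed.

Lemma aff_actM a b v : aff_act (a * b) v = aff_act a (aff_act b v).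
Proof. by rewrite /aff_act mulmxDr mulmxA addrA. Qed.

(* The coordinates of Aff(V) as an open subvariety of the affine space of
   pairs (matrix, vector). Polynomials in these coordinates and 1 / det define
   the same closed subsets of Aff(V) as polynomials in the coordinates only. *)
Definition aff_coord a : 'rV[R]_(n * n + n) :=
  row_mx (mxvec (aff_lin a)) (aff_trans a)^T.

Definition zariski_closed (A : set Aff) : Prop :=
  exists P : set (mpoly.mpoly (n * n + n) R),
    A = [set a | forall p, P p -> mpoly.meval (aff_coord a 0%R) p = 0%R].

Definition acts_transitively (A : set Aff) : Prop :=
  forall x y : V, exists2 a, A a & aff_act a x = y.

Definition properly_discontinuous (G : set Aff) : Prop :=
  forall K : set V, compact K ->
    finite_set [set g | G g /\ (aff_act g @` K) `&` K !=set0].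

Section OrbitSpace.
Variables (G : set Aff) (hG : is_subgroup G).

Definition orbit_rel : rel V :=
  fun x y => `[< exists2 g, G g & aff_act g x = y >].

Lemma orbit_refl : reflexive orbit_rel.
Proof. by case: hG => G1 _ _ x; apply/asboolP; exists 1; rewrite ?aff_act1. Qed.

Lemma orbit_sym : symmetric orbit_rel.
Proof.
case: hG => _ _ GV.
suff h x y : orbit_rel x y -> orbit_rel y x by move=> x y; apply/idP/idP; exact: h.
move=> /asboolP[g Gg <-]; apply/asboolP; exists g^-1; first exact: GV.
by rewrite -aff_actM mulVg aff_act1.
Qed.

Lemma orbit_trans : transitive orbit_rel.
Proof.
case: hG => _ GM _ y x z /asboolP[g Gg <-] /asboolP[h Gh <-].
by apply/asboolP; exists (h * g); rewrite ?aff_actM//; exact: GM.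
Qed.

Definition orbit_equiv : equiv_rel V := EquivRel _ orbit_refl orbit_sym orbit_trans.

Definition orbit_space := quotient_topology {eq_quot orbit_equiv}%qT.

End OrbitSpace.

Definition affine_crystallographic (G : set Aff) : Prop :=
  exists hG : is_subgroup G,
    properly_discontinuous G /\ compact [set: orbit_space hG].

Section TypeA.
Variable A : set Aff.

Definition crystallographic_of_type (G : set Aff) : Prop :=
  affine_crystallographic G /\ G `<=` A.

Definition isomorphic_to_subgroup (Gamma : groupType) (G : set Aff) : Prop :=
  exists rho : Gamma -> Aff,
    {morph rho : x y / x * y} /\ set_bij [set: Gamma] G rho.

Definition realizable_as_crystallographic (Gamma : groupType) : Prop :=
  exists2 G, crystallographic_of_type G & isomorphic_to_subgroup Gamma G.

Section Deformations.
Variable Gamma : groupType.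

Definition Hom_c : set (Gamma -> Aff) :=
  [set rho | [/\ {morph rho : x y / x * y}, injective rho,
                 range rho `<=` A & affine_crystallographic (range rho)]].

Definition conj_orbit (rho : Gamma -> Aff) : set (Gamma -> Aff) :=
  [set (fun x => a * rho x * a^-1) | a in A].

Definition D_c : set (set (Gamma -> Aff)) := [set conj_orbit rho | rho in Hom_c].

Definition aut_act (phi : Aut Gamma) (rho : Gamma -> Aff) : Gamma -> Aff :=
  rho \o (phi^-1)%g.

(* The induced action of Out Gamma on D_c, on classes represented as sets; see
   out_act_lcoset. *)
Definition out_act (o : set (Aut Gamma)) (x : set (Gamma -> Aff)) :
    set (Gamma -> Aff) :=
  [set aut_act phi rho | phi in o & rho in x].

Lemma out_act_lcoset (phi : Aut Gamma) (rho : Gamma -> Aff) :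
    is_subgroup A -> Hom_c rho ->
  out_act (lcoset (@Inn Gamma) phi) (conj_orbit rho) =
  conj_orbit (aut_act phi rho).
Proof.
move=> [_ AM AV] [rhoM _ rhoA _]; apply/seteqP; split=> sigma.
- move=> [_ [eta [g hg] <-] [_ [a Aa <-] <-]].
  exists (a * (rho g)^-1).
    by apply: AM => //; apply: AV; apply: rhoA; exists g.
  have rho1 : rho 1 = 1 by apply: (mulgI (rho 1)); rewrite -rhoM !mulg1.
  have rhoV x : rho x^-1 = (rho x)^-1.
    by apply: (mulgI (rho x)); rewrite -rhoM !mulgV.
  apply/funext => x.
  rewrite -[RHS]/(a * rho ((phi * eta)^-1 x) * a^-1) -[aut_act _ _ _]/(rho (phi^-1 x)).
  have -> : (phi * eta)^-1 x = g^-1 * phi^-1 x * g.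
    rewrite invgM; apply: (can_inj (aut_funK eta)).
    rewrite -[eta _ in LHS]/((eta * (eta^-1 * phi^-1)) x) mulVKg hg.
    by rewrite !mulgA mulgV mul1g -!mulgA mulgV mulg1.
  by rewrite !rhoM rhoV invgM invgK !mulgA.
- move=> [a Aa <-]; exists phi.
    exists 1; last by rewrite mulg1.
    by exists 1 => x; rewrite mul1g invg1 mulg1.
  by exists (fun x => a * rho x * a^-1) => //; exists a.
Qed.

End Deformations.

Definition kernel_has_fixed_point (Gamma Delta : groupType)
    (i : {multiplicative Gamma -> Delta}) : Prop :=
  exists2 x : set (Gamma -> Aff), D_c x &
    forall f, quotient_group (range i) f -> out_act (abstract_kernel i f) x = x.

End TypeA.
End Affine.

(* Main.v *)
Require Import Defs.
From mathcomp Require Import all_boot all_order all_algebra.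
From mathcomp Require mpoly.
From mathcomp Require Import all_classical all_reals topology normedtype.

Set Implicit Arguments.
Unset Strict Implicit.
Unset Printing Implicit Defensive.

Import Order.TTheory GRing.Theory Num.Def Num.Theory numFieldNormedType.Exports.

Local Open Scope classical_set_scope.
Local Open Scope ring_scope.

(** Write G for the image of rho : Gamma -> A, and regard an affine map of V as
    a matrix acting on R (+) V, with V the hyperplane of points of first
    coordinate 1.

    If Delta is realized by sigma, then sigma restricts to a realization of
    the finite index subgroup Gamma, and conjugation by d in Delta changes this
    restriction by conjugation by sigma d in A: its class is a fixed point
    ([realizable_fixed_point]).

    Conversely, a fixed point provides for each d in Delta some s(d) in A which
    conjugates rho as d conjugates Gamma. We may take s(d g) = s(d) rho(g) for g
    in Gamma. The defect s(d) s(e) s(d e)^-1 then centralizes G and depends only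
    on the cosets of d and e: it is a 2-cocycle of the finite group Delta/Gamma
    with values in the centralizer C of G in A. The point is that C is
    unipotent and divisible, so that the cocycle can be trivialized.

    - C is unipotent. Let N be the algebra of endomorphisms X of R (+) V that
      commute with G and take values in V; then c - 1 lies in N for c in C.
      Every X in N is nilpotent ([commutant_nilpotent]). Indeed, by Fitting's
      lemma, V is otherwise the product of a G-invariant affine subspace W and
      of a nonzero vector space I on which G acts linearly. As G acts properly
      on W, only finitely many elements of G bring a point of {w} x I to a given
      compact set, so that they cannot bring all of {w} x I there, against the
      compactness of V/G. An algebra of nilpotent matrices is nilpotent
      ([annihilated_full]), which filters N by ideals N_1 = N, N_2, ..., with
      N_j N_k inside N_(j+k) and N_j = 0 for large j.
    - C is divisible. For c = 1 + x in C, the power c^t is a polynomial in t.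
      Since A is Zariski closed and contains c^t for natural t, it contains
      c^t for every real t, and c^t - 1 = t x modulo higher order terms
      ([closed_unipotent_root]).

    If all defects lie in 1 + N_j, they are additive modulo N_(j+1), and
    averaging the cocycle over Delta/Gamma, as in the proof that the cohomology
    of a finite group in a vector space vanishes, produces a correction of s
    with defects in 1 + N_(j+1) ([defect_level_step]). After finitely many steps
    s is a homomorphism extending rho. Its kernel meets Gamma trivially, hence
    centralizes Gamma, hence is trivial because the extension is effective; and
    its image contains G with finite index, so it is crystallographic. *)

(** * Crystallographic actions in terms of the norm *)

Section Metric.
Local Open Scope quotient_scope.
Variables (R : realType) (n : nat).
Local Notation V := 'cV[R]_n.
Implicit Types (G : set (Aff R n)) (x : V).

Lemma ler_entry_mx_norm p q (M : 'M[R]_(p, q)) i j : `|M i j| <= `|M|.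
Proof.
by rewrite [leRHS]/normr /= mx_normrE; apply/bigmax_geP; right => /=; exists (i, j).
Qed.

Lemma mx_norm_le p q (M : 'M[R]_(p, q)) (B : R) :
  0 <= B -> (forall i j, `|M i j| <= B) -> `|M| <= B.
Proof.
move=> B0 h; rewrite [leLHS]/normr /= mx_normrE; apply/bigmax_leP; split => //.
Qed.

Lemma mulmx_bounded p q r (M : 'M[R]_(p, q)) :
  exists2 C : R, 0 <= C & forall N : 'M_(q, r), `|M *m N| <= C * `|N|.
Proof.
exists (\sum_i \sum_j `|M i j|).
  by apply: sumr_ge0 => i _; apply: sumr_ge0.
move=> N; apply: mx_norm_le.
  by apply: mulr_ge0 => //; apply: sumr_ge0 => i _; apply: sumr_ge0.
move=> i j; rewrite mxE; apply: le_trans (ler_norm_sum _ _ _) _.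
have : \sum_k `|M i k| <= \sum_i0 \sum_j0 `|M i0 j0|.
  rewrite [leRHS](bigD1 i)//= lerDl.
  by apply: sumr_ge0 => ? _; apply: sumr_ge0.
move=> /(ler_wpM2r (normr_ge0 N)); apply: le_trans.
rewrite mulr_suml; apply: ler_sum => k _; rewrite normrM.
by apply: ler_wpM2l => //; exact: ler_entry_mx_norm.
Qed.

Lemma closed_ball_compact (B : R) : compact [set x : V | `|x| <= B].
Proof.
have -> : [set x : V | `|x| <= B] = trmx @` [set v : 'rV[R]_n | `|v| <= B].
  have tn p q (M : 'M[R]_(p, q)) : `|M^T| <= `|M|.
    by apply: mx_norm_le => // i j; rewrite mxE; exact: ler_entry_mx_norm.
  apply/seteqP; split => [x xB|_ [v vB <-]]; last exact: le_trans (tn _ _ _) vB.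
  by exists x^T; rewrite ?trmxK//; exact: le_trans (tn _ _ _) xB.
apply: continuous_compact.
  apply: continuous_subspaceT => v A [P Pv PA].
  exists (fun i j => P j i) => [i j|w hw]; first by have := Pv j i; rewrite mxE.
  by apply: PA => i j; have := hw j i; rewrite mxE.
apply: bounded_closed_compact.
  exists B; split; first exact: num_real.
  by move=> M BM v /= vB; exact/ltW/(le_lt_trans vB).
apply: (@closed_comp _ _ (fun v : 'rV[R]_n => `|v|) [set r : R | r <= B]).
  by move=> x _; exact: norm_continuous.
exact: closed_le.
Qed.

Lemma compact_sub_ball (K : set V) : compact K ->
  exists B : R, forall x, K x -> `|x| <= B.
Proof.
move=> /compact_bounded [M [_ h]]; exists (M + 1) => x Kx.
by apply: (h (M + 1)) => //; rewrite ltrDl.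
Qed.

Lemma aff_act_bounded (g : Aff R n) (B : R) :
  exists B' : R, forall x, `|x| <= B -> `|aff_act g x| <= B'.
Proof.
have [C C0 hC] := mulmx_bounded 1 (aff_lin g).
exists (C * B + `|aff_trans g|) => x xB; rewrite /aff_act.
apply: le_trans (ler_normD _ _) _; rewrite lerD2r.
by apply: le_trans (hC x) _; apply: ler_wpM2l.
Qed.

Lemma aff_act_continuous (g : Aff R n) : continuous (aff_act g).
Proof.
have [C C0 hC] := mulmx_bounded 1 (aff_lin g).
move=> x A /nbhs_ballP[e /= e0 eA]; apply/nbhs_ballP.
exists ((C + 1)^-1 * e) => [|y]; first by rewrite /= mulr_gt0 // invr_gt0 ltr_wpDl.
rewrite mx_norm_ball /= => xy; apply: eA; rewrite mx_norm_ball /aff_act /ball_ /=.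
rewrite opprD addrACA subrr addr0 -mulmxBr.
apply: le_lt_trans (hC _) _.
apply: (@le_lt_trans _ _ ((C + 1) * `|x - y|)).
  by apply: ler_wpM2r => //; rewrite lerDl.
by rewrite -ltr_pdivlMl ?ltr_wpDl.
Qed.

(** Both conditions are measured on norm balls. They make a topological
    statement about the orbit space checkable on subgroups and overgroups. *)
Definition cobounded G : Prop :=
  exists B : R, forall x, exists2 g, G g & `|aff_act g x| <= B.

Definition metrically_proper G : Prop :=
  forall B : R, finite_set
    [set g | G g /\ exists2 x, `|x| <= B & `|aff_act g x| <= B].

(** By the Heine-Borel theorem it suffices to test closed balls. *)
Lemma properly_discontinuousP G :
  properly_discontinuous G <-> metrically_proper G.
Proof.
split=> [pd B|mp K /compact_sub_ball[B KB]].
  have fin := pd _ (@closed_ball_compact B).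
  apply: (sub_finite_set _ fin) => g [Gg [x xB gxB]].
  by split=> //; exists (aff_act g x); split => //; exists x.
apply: (sub_finite_set _ (mp B)) => g [Gg [_ [[x Kx <-] Kgx]]].
by split=> //; exists x; exact: KB.
Qed.

(** The images of the open balls of integral radius form an increasing open
    cover of the orbit space, so one of them is everything if the latter is
    compact; conversely the orbit space is then the image of a closed ball. *)
Lemma compact_orbit_spaceP G (hG : is_subgroup G) :
  compact [set: orbit_space hG] <-> cobounded G.
Proof.
have piP x y : (\pi_(orbit_space hG) x = \pi_(orbit_space hG) y) ->
    exists2 g, G g & aff_act g x = y.
  by move=> /eqmodP /asboolP.
split=> [/compact_near_coveringP cpt|[B hB]]; last first.
  suff -> : [set: orbit_space hG] =
      (\pi_(orbit_space hG) : V -> orbit_space hG) @` [set x : V | `|x| <= B].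
    apply: continuous_compact (@closed_ball_compact B).
    exact/continuous_subspaceT/pi_continuous.
  apply/seteqP; split => // q _; have [g Gg gB] := hB (repr q).
  exists (aff_act g (repr q)) => //; rewrite -[RHS]reprK.
  by apply/esym/eqmodP/asboolP; exists g.
pose P (k : nat) (q : orbit_space hG) :=
  exists2 x : V, \pi_(orbit_space hG) x = q & `|x| <= k%:R.
have [k _ hk] : \forall k \near \oo, [set: orbit_space hG] `<=` P k.
  apply: cpt => q _.
  have [k qk] : exists k : nat, `|repr q| < k%:R.
    exists (Num.truncn `|repr q|).+1; exact: truncnS_gt.
  pose U := [set q : orbit_space hG | exists2 x : V,
    \pi_(orbit_space hG) x = q & `|x| < k%:R].
  have oU : open U.
    have oB : open [set x : V | `|x| < k%:R].
      apply: (@open_comp _ _ (fun v : V => `|v|) [set r : R | r < k%:R]).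
        by move=> x _; exact: norm_continuous.
      exact: open_lt.
    suff : open ((\pi_(orbit_space hG) : V -> orbit_space hG) @^-1` U) by [].
    have -> : (\pi_(orbit_space hG) : V -> orbit_space hG) @^-1` U =
        \bigcup_(g in G) (aff_act g @^-1` [set x : V | `|x| < k%:R]).
      apply/seteqP; split => x.
        move=> [y /esym/piP[g Gg gx] yk]; exists g => //=.
        by rewrite gx.
      move=> [g Gg gxk]; exists (aff_act g x) => //.
      by apply/esym/eqmodP/asboolP; exists g.
    apply: bigcup_open => g _; apply: open_comp oB => x _.
    exact: aff_act_continuous.
  exists (U, [set j | (k <= j)%N]).
    split; last by exists k.
    apply: open_nbhs_nbhs; split => //.
    by exists (repr q) => //; rewrite reprK.
  move=> [q' j] /= [[x xq xk] kj]; exists x => //.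
  by apply: le_trans (ltW xk) _; rewrite ler_nat.
exists k%:R => x.
have [y /esym/piP[g Gg <-] yk] := hk k (leqnn k) (\pi_(orbit_space hG) x) I.
by exists g.
Qed.

Lemma affine_crystallographicP G : affine_crystallographic G <->
  [/\ is_subgroup G, metrically_proper G & cobounded G].
Proof.
split=> [[hG [/properly_discontinuousP pd /compact_orbit_spaceP cb]]//|].
by case=> hG mp cb; exists hG; split;
  [exact/properly_discontinuousP|exact/compact_orbit_spaceP].
Qed.

End Metric.

(** * Endomorphisms commuting with a crystallographic group *)

Lemma finite_set_bounded (R : realType) (T : choiceType) (S : set T) (f : T -> R) :
  finite_set S -> exists M : R, forall x, S x -> f x <= M.
Proof.
move=> /finite_seqP[s ->]; exists (\sum_(x <- s) `|f x|) => x /= xs.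
rewrite (big_rem x)//= (le_trans (ler_norm _))// lerDl.
exact: sumr_ge0.
Qed.

Section Commutant.
Variables (R : realType) (n : nat).
Local Notation V := 'cV[R]_n.
Implicit Types (G : set (Aff R n)) (v : V) (a b : Aff R n).

(** Homogeneous coordinates: affine maps become the invertible matrices with
    first row (1, 0, ..., 0), so that one may add them. *)
Definition hat a : 'M[R]_n.+1 :=
  block_mx (1%:M : 'M_1) 0 (aff_trans a) (aff_lin a).

Definition point v : 'cV[R]_n.+1 := col_mx (1%:M : 'M_1) v.
Definition direction v : 'cV[R]_n.+1 := col_mx (0 : 'M_1) v.

Lemma hat1 : hat 1%g = 1.
Proof.
by rewrite /hat /aff_trans /aff_lin /= -scalar_mx_block.
Qed.

Lemma hatM a b : hat (a * b)%g = hat a * hat b.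
Proof.
rewrite /hat -[RHS]/(_ *m _) (@mulmx_block _ 1 n 1 n 1 n).
rewrite !mulmx1 !mulmx0 !mul0mx !addr0 add0r.
by rewrite [in LHS]/aff_trans [in LHS]/aff_lin /= [X in block_mx _ _ X _]addrC.
Qed.

Lemma hat_inj : injective hat.
Proof.
move=> a b /(@eq_block_mx _ 1 n 1 n)[_ _ et el]; apply: val_inj => /=.
case: a b et el => [[la ta] ua] [[lb tb] ub] /=.
by rewrite /aff_trans /aff_lin /= => -> ->.
Qed.

Lemma hatVK a : hat a^-1%g * hat a = 1.
Proof. by rewrite -hatM mulVg hat1. Qed.

Lemma hatKV a : hat a * hat a^-1%g = 1.
Proof. by rewrite -hatM mulgV hat1. Qed.

Lemma hat_point a v : hat a *m point v = point (aff_act a v).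
Proof.
rewrite /hat /point (@mul_block_col _ 1 n 1 n 1) mulmx1 mul0mx addr0.
by rewrite mulmx1 addrC.
Qed.

Lemma hat_direction a v : hat a *m direction v = direction (aff_lin a *m v).
Proof.
by rewrite /hat /direction (@mul_block_col _ 1 n 1 n 1) !mulmx0 mul0mx !add0r.
Qed.

Lemma hat_ex (Y : 'M[R]_n.+1) : Y \in unitmx ->
  @usubmx _ 1 n n.+1 Y = @usubmx _ 1 n n.+1 1%:M -> exists a, hat a = Y.
Proof.
move=> uY eY; pose Y' : 'M[R]_(1 + n) := Y.
have ul : ulsubmx Y' = 1%:M.
  rewrite /ulsubmx [usubmx _]eY; apply/matrixP => i j; rewrite !mxE.
  by rewrite eqE /= !ord1.
have ur : ursubmx Y' = 0.
  rewrite /ursubmx [usubmx _]eY; apply/matrixP => i j; rewrite !mxE.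
  by rewrite eqE /= !ord1.
have EY : Y' = block_mx 1%:M 0 (dlsubmx Y') (drsubmx Y').
  by rewrite -[LHS]submxK ul ur.
have ul' : drsubmx Y' \in unitmx.
  have : Y' \in unitmx by [].
  by rewrite {1}EY !unitmxE det_lblock det1 mul1r.
exists (@MkAff _ _ (drsubmx Y', dlsubmx Y') ul').
by rewrite [RHS]EY.
Qed.

(** The endomorphisms with values in the space of directions that commute with
    G. The affine maps centralizing G are the invertible 1 + X with X in this
    set, see [commutant_hatP]. *)
Definition commutant G : set 'M[R]_n.+1 :=
  [set X | @usubmx _ 1 n n.+1 X = 0 /\ forall g, G g -> X * hat g = hat g * X].

Lemma direction_ex (z : 'cV[R]_n.+1) : @usubmx _ 1 n 1 z = 0 ->
  exists v, z = direction v.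
Proof.
by move=> z0; exists (@dsubmx _ 1 n 1 z); rewrite -[LHS](@vsubmxK _ 1 n 1) z0.
Qed.

Lemma point_ex (z : 'cV[R]_n.+1) : @usubmx _ 1 n 1 z = 1%:M ->
  exists v, z = point v.
Proof.
by move=> z0; exists (@dsubmx _ 1 n 1 z); rewrite -[LHS](@vsubmxK _ 1 n 1) z0.
Qed.

Lemma direction_norm v : `|v| <= `|direction v|.
Proof.
apply: mx_norm_le => // i j.
have -> : v i j = direction v (@rshift 1 n i) j.
  exact/esym/(@col_mxEd _ 1 n 1).
exact: ler_entry_mx_norm.
Qed.

Lemma point_bounded (B : R) : exists B', forall v, `|v| <= B -> `|point v| <= B'.
Proof.
have [C C0 hC] := mulmx_bounded 1 (col_mx (0 : 'M[R]_(1, n)) 1%:M).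
exists (`|point 0| + C * B) => v vB.
have -> : point v = point 0 + col_mx (0 : 'M[R]_(1, n)) 1%:M *m v.
  by rewrite /point mul_col_mx mul0mx mul1mx (@add_col_mx _ 1 n 1) addr0 add0r.
apply: le_trans (ler_normD _ _) _; rewrite lerD2l.
by apply: le_trans (hC v) _; apply: ler_wpM2l.
Qed.

Lemma usubmxM (X Y : 'M[R]_n.+1) :
  @usubmx _ 1 n _ (X * Y) = @usubmx _ 1 n _ X *m Y.
Proof. by rewrite -mul_usub_mx. Qed.

Lemma commutantM G X Y : commutant G X -> commutant G Y -> commutant G (X * Y).
Proof.
move=> [X0 cX] [_ cY]; split; first by rewrite usubmxM X0 mul0mx.
by move=> g Gg; rewrite -mulrA cY// !mulrA cX.
Qed.

Lemma commutantX G X k : commutant G X -> commutant G (X ^+ k.+1).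
Proof.
by move=> cX; elim: k => [|k ih]; rewrite ?expr1// exprS; apply: commutantM.
Qed.

(** Fitting's lemma in equational form: for the power Y of X of least rank,
    left multiplication by Y is injective on the image of Y, with inverse given
    by D, and the image of Y is a complement to its kernel. *)
Lemma rank_fitting (m : nat) (X : 'M[R]_m.+1) : exists (k : nat),
  exists D, exists D', X ^+ k.+1 = D * X ^+ k.+1 * X ^+ k.+1 /\
            X ^+ k.+1 = X ^+ k.+1 * X ^+ k.+1 * D'.
Proof.
have [k hk] : exists k, forall j, (\rank (X ^+ k.+1) <= \rank (X ^+ j.+1))%N.
  have ex : exists r, `[< exists k, r = \rank (X ^+ k.+1) >].
    by exists (\rank (X ^+ 1)); apply/asboolP; exists 0%N.
  have [r /asboolP[k ->] rmin] := ex_minnP ex.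
  by exists k => j; apply: rmin; apply/asboolP; exists j.
have rYY : \rank (X ^+ k.+1 *m X ^+ k.+1) = \rank (X ^+ k.+1).
  apply/eqP; rewrite eqn_leq mxrankM_maxl /=.
  by rewrite mulmxE -exprD addSn; exact: (hk (k + k.+1)%N).
exists k; move: (X ^+ k.+1) rYY => Y rYY.
have /submxP[D eD] : (Y <= Y *m Y)%MS.
  by rewrite -(geq_leqif (mxrank_leqif_sup (submxMl Y Y))) rYY.
have /submxP[D' eD'] : (Y^T <= Y^T *m Y^T)%MS.
  rewrite -(geq_leqif (mxrank_leqif_sup (submxMl _ _))).
  by rewrite -trmx_mul !mxrank_tr rYY.
exists D, D'^T; split; first by rewrite {1}eD mulmxA.
by rewrite -[LHS]trmxK eD' !trmx_mul !trmxK.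
Qed.

(** Let Y be a power of X as in [rank_fitting], and assume that b = Y u is
    nonzero. The kernel of Y contains a point v0. An element g of G that brings
    v0 + t b into the ball of radius B maps t b to a vector of bounded length,
    because this vector is recovered from Y (g (v0 + t b)) = Y (g (t b)) by
    applying D. Hence g moves v0 by a bounded amount, which leaves finitely many
    possibilities for g, and then t b has bounded length. This is absurd for
    large t. *)
Lemma commutant_nilpotent G X : metrically_proper G -> cobounded G ->
  commutant G X -> exists k, X ^+ k = 0.
Proof.
move=> mp [B hB] cX; have [k [D [D' [eD eD']]]] := rank_fitting X.
exists k.+1; have [Y0 cY] := commutantX k cX.
move: (X ^+ k.+1) eD eD' Y0 cY => Y eD eD' Y0 cY.
apply/eqP/negPn/negP => /eqP Yn0.
have Y0r (z : 'cV[R]_n.+1) : @usubmx _ 1 n 1 (Y *m z) = 0.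
  by rewrite -mul_usub_mx Y0 mul0mx.
have [u Yu] : exists u : 'cV_n.+1, Y *m u != 0.
  apply/not_existsP => h; apply: Yn0; apply/matrixP => i j.
  have /negP/negPn/eqP := h (delta_mx j 0).
  by move=> /matrixP/(_ i 0); rewrite -colE !mxE.
have [b eb] := direction_ex (Y0r u).
have b0 : `|b| > 0.
  rewrite normr_gt0; apply: contraNneq Yu => b0.
  by rewrite eb b0 /direction col_mx0.
have [v0 ev0] : exists v0, point 0 - Y *m (D' *m point 0) = point v0.
  by apply: point_ex; rewrite raddfB /= Y0r subr0 /point col_mxKu.
have Yv0 : Y *m point v0 = 0.
  have eY : Y *m Y *m D' = Y := esym eD'.
  by rewrite -ev0 mulmxBr !mulmxA eY subrr.
have ept t : point (v0 + t *: b) = point v0 + t *: (Y *m u).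
  rewrite eb /point /direction (@scale_col_mx _ 1 n 1) (@add_col_mx _ 1 n 1).
  by rewrite scaler0 addr0.
have [C C0 hC] := mulmx_bounded 1 (D *m Y).
have [B1 hB1] := point_bounded B.
have key g t : G g -> `|aff_act g (v0 + t *: b)| <= B ->
    `|t *: (aff_lin g *m b)| <= C * B1.
  move=> Gg gB; apply: le_trans (direction_norm _) _.
  suff -> : direction (t *: (aff_lin g *m b)) =
      D *m Y *m point (aff_act g (v0 + t *: b)).
    by apply: le_trans (hC _) _; apply: ler_wpM2l => //; exact: hB1.
  have -> : direction (t *: (aff_lin g *m b)) = t *: (hat g *m (Y *m u)).
    by rewrite eb hat_direction /direction (@scale_col_mx _ 1 n 1) scaler0.
  rewrite -hat_point ept mulmxDr -!mulmxA.
  have cYg z : Y *m (hat g *m z) = hat g *m (Y *m z).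
    by rewrite !mulmxA; congr (_ *m z); exact: cY.
  rewrite mulmxDr cYg Yv0 mulmx0 add0r -!scalemxAr; congr (_ *: _).
  by rewrite -!cYg [in LHS]eD -!mulmxE -!mulmxA.
(* B2 bounds both v0 and its translates by the elements g of [key]. *)
pose B2 := Num.max `|v0| (B + C * B1).
have fin := mp B2.
have /finite_set_bounded : finite_set
    [set g | G g /\ exists2 x, `|x| <= B2 & `|aff_act g x| <= B2] by [].
pose cst g := xget 0 [set c : R | 0 <= c /\
   forall N : V, `|invmx (aff_lin g) *m N| <= c * `|N|].
have cstP g : 0 <= cst g /\ forall N : V, `|invmx (aff_lin g) *m N| <= cst g * `|N|.
  have [c c0 hc] := mulmx_bounded 1 (invmx (aff_lin g)).
  by apply: (xgetPex 0 (P := [set c : R | 0 <= c /\ _])); exists c.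
move=> /(_ R cst)[M hM].
(* This t makes the length of t b exceed the bound M * (C * B1) by 1. *)
pose t := (M * (C * B1) + 1) / `|b|.
have [g Gg gB] := hB (v0 + t *: b).
have kg := key g t Gg gB.
have gS : cst g <= M.
  apply: hM; split=> //; exists v0; first by rewrite /B2 le_max lexx.
  have -> : aff_act g v0 = aff_act g (v0 + t *: b) - t *: (aff_lin g *m b).
    by rewrite /aff_act mulmxDr -scalemxAr addrAC addrK.
  rewrite /B2 le_max; apply/orP; right.
  by apply: le_trans (ler_normB _ _) _; apply: lerD.
have := (cstP g).2 (t *: (aff_lin g *m b)).
rewrite -scalemxAr mulKmx ?aff_unit// => tb.
have : `|t *: b| <= M * (C * B1).
  apply: le_trans tb _; apply: ler_pM => //; exact: (cstP g).1.
have CB1 : 0 <= C * B1 by apply: le_trans kg.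
have M0 : 0 <= M by apply: le_trans gS; exact: (cstP g).1.
have t0 : 0 <= M * (C * B1) + 1 by rewrite addr_ge0 // mulr_ge0.
rewrite normrZ ger0_norm; last by rewrite /t divr_ge0// ltW.
by rewrite /t divfK ?gt_eqF// leNgt ltrDl ltr01.
Qed.

End Commutant.

(** * Algebras of nilpotent matrices *)

Section NilAlgebra.
Variables (F : fieldType) (m : nat).
Local Notation M := 'M[F]_m.+1.
Local Notation V := 'cV[F]_m.+1.

Definition linear_set (vT : lmodType F) (P : set vT) : Prop :=
  [/\ P 0, (forall u v, P u -> P v -> P (u + v)) & forall a u, P u -> P (a *: u)].

Lemma linear_set_vspace (vT : vectType F) (P : set vT) : linear_set P ->
  exists U : {vspace vT}, forall v, v \in U <-> P v.
Proof.
move=> [P0 PD PZ].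
pose ok d := `[< exists2 U : {vspace vT}, \dim U = d & forall v, v \in U -> P v >].
have ex : exists d, ok d.
  exists 0%N; apply/asboolP; exists 0%VS; first exact: dimv0.
  by move=> v; rewrite memv0 => /eqP ->.
have bd d : ok d -> (d <= \dim {:vT})%N.
  by move=> /asboolP[U <- _]; apply: dimvS; exact: subvf.
have [d /asboolP[U dU UP] dmax] := ex_maxnP ex bd.
exists U => v; split; first exact: UP.
move=> Pv; have : ok (\dim (U + <[v]>)%VS).
  apply/asboolP; exists (U + <[v]>)%VS => // _ /memv_addP[u uU [_ /vlineP[a ->] ->]].
  by apply: PD; [exact: UP | exact: PZ].
move=> /dmax; rewrite -dU => le.
have /eqP -> : (U == U + <[v]>)%VS by rewrite eqEdim addvSl.
by apply: (subvP (addvSr _ _)); exact: memv_line.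
Qed.

Variable N : set M.
Hypothesis Nlin : linear_set N.
Hypothesis NM : forall X Y, N X -> N Y -> N (X * Y).

Fixpoint annihilated (k : nat) : set V :=
  if k is k'.+1 then [set v | forall X, N X -> annihilated k' (X *m v)]
  else [set 0].

Lemma annihilated_linear k : linear_set (annihilated k).
Proof.
elim: k => [|k [L0 LD LZ]].
  by split => //= [u v -> ->|a u ->]; rewrite ?addr0 ?scaler0.
split => [X _|u v hu hv X NX|a u hu X NX].
- by rewrite mulmx0.
- by rewrite mulmxDr; apply: LD; [exact: hu | exact: hv].
- by rewrite -scalemxAr; apply: LZ; exact: hu.
Qed.

Lemma annihilatedS k : annihilated k `<=` annihilated k.+1.
Proof.
elim: k => [|k ih] v; first by move=> -> X _; rewrite mulmx0.
by move=> hv X NX; apply: ih; exact: hv.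
Qed.

Lemma annihilated_le k l : (k <= l)%N -> annihilated k `<=` annihilated l.
Proof.
move=> /subnK <-; elim: (l - k)%N => [|j ih] v hv //.
by rewrite addSn; apply: annihilatedS; exact: ih.
Qed.

Lemma annihilatedM k X v : N X -> annihilated k v -> annihilated k.-1 (X *m v).
Proof.
case: k => [|k] NX; first by move=> ->; rewrite mulmx0.
by apply.
Qed.

Hypothesis Nnil : forall X, N X -> exists k, X ^+ k = 0.

(** Among the vectors w outside L_k := annihilated k, take one such that N w + L_k
    has least dimension. If N w is not inside L_k, some X w is outside L_k, and
    N X w + L_k = N w + L_k by minimality. So X w = Y X w modulo L_k for some Y in
    N, and X w lies in L_k since Y is nilpotent. *)
Lemma annihilated_strict k w0 : ~ annihilated k w0 ->
  exists2 w, annihilated k.+1 w & ~ annihilated k w.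
Proof.
have [N0 ND NZ] := Nlin; have [L0 LD LZ] := annihilated_linear k.
pose Q w : set V := [set y | exists X l, [/\ N X, annihilated k l & y = X *m w + l]].
have Qlin w : linear_set (Q w).
  split.
  - by exists 0, 0; rewrite mul0mx addr0.
  - move=> _ _ [X [l [NX Ll ->]]] [X' [l' [NX' Ll' ->]]].
    exists (X + X'), (l + l'); split; [exact: ND|exact: LD|].
    by rewrite mulmxDl addrACA.
  - move=> a _ [X [l [NX Ll ->]]]; exists (a *: X), (a *: l).
    by split; [exact: NZ|exact: LZ|rewrite scalerDr scalemxAl].
have [U hU] := choice (fun w => linear_set_vspace (Qlin w)).
move=> kw0.
have ex : exists d, `[< exists2 w, ~ annihilated k w & \dim (U w) = d >].
  by exists (\dim (U w0)); apply/asboolP; exists w0.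
have [d /asboolP[w kw dw] dmin] := ex_minnP ex.
exists w => // X NX; apply: contrapT => kXw.
have sub : (U (X *m w) <= U w)%VS.
  apply/subvP => y /hU[Y [l [NY Ll ->]]]; apply/hU.
  by exists (Y * X), l; split=> //; [exact: NM|rewrite mulmxA].
have eU : U (X *m w) = U w.
  by apply/eqP; rewrite eqEdim sub dw; apply: dmin; apply/asboolP; exists (X *m w).
have : X *m w \in U (X *m w).
  by rewrite eU; apply/hU; exists X, 0; rewrite addr0.
move=> /hU[Y [l [NY Ll eXw]]]; apply: kXw.
have Linv Z v : N Z -> annihilated k v -> annihilated k (Z *m v).
  by move=> NZ' Lv; apply: annihilated_le (leq_pred k) _ _; exact: annihilatedM.
have [j Yj] := Nnil NY.
(* Iterate X w = Y X w modulo L_k. *)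
have step : forall j, annihilated k (X *m w - Y ^+ j *m (X *m w)).
  elim=> [|i ih]; first by rewrite expr0 mul1mx subrr.
  have -> : X *m w - Y ^+ i.+1 *m (X *m w) =
      l + Y *m (X *m w - Y ^+ i *m (X *m w)).
    rewrite mulmxBr {1}eXw -addrA addrCA; congr (_ + _).
    by rewrite exprS -mulmxE !mulmxA.
  by apply: LD => //; exact: Linv.
by have := step j; rewrite Yj mul0mx subr0.
Qed.

Lemma annihilated_full : exists k, forall v, annihilated k v.
Proof.
have [U hU] := choice (fun k => linear_set_vspace (annihilated_linear k)).
apply: contrapT => /forallNP h.
have key k : (k <= \dim (U k))%N.
  elim: k => // k ih; apply: leq_ltn_trans ih _.
  have /existsNP[w0 /annihilated_strict[w kw1 kw]] := h k.
  have sub : (U k <= U k.+1)%VS.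
    by apply/subvP => v /hU/annihilatedS/hU.
  rewrite ltn_neqAle dimvS// andbT; apply/eqP => e.
  have /eqP eU : U k == U k.+1 by rewrite eqEdim sub e leqnn.
  by apply: kw; apply/hU; rewrite eU; apply/hU.
have := key (\dim {:V}).+1; rewrite leqNgt ltnS => /negP; apply.
exact/dimvS/subvf.
Qed.

(** Defining the filtration by its effect on the annihilators, and not by spans
    of products of elements of N, makes each stage a linear subspace that is
    compatible with products and conjugations by construction. *)
Definition nil_filtration (j : nat) : set M := [set X |
  N X /\ forall k v, annihilated k v -> annihilated (k - j) (X *m v)].

Local Notation Nf := nil_filtration.

Lemma nil_filtration_linear j : linear_set (Nf j).
Proof.
have [N0 ND NZ] := Nlin.
split=> [|X Y [NX hX] [NY hY]|a X [NX hX]].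
- by split=> // k v _; rewrite mul0mx; have [] := annihilated_linear (k - j).
- split; first exact: ND.
  move=> k v Lv; rewrite mulmxDl; have [_ LD _] := annihilated_linear (k - j).
  by apply: LD; [exact: hX|exact: hY].
- split; first exact: NZ.
  move=> k v Lv; rewrite -scalemxAl; have [_ _ LZ] := annihilated_linear (k - j).
  by apply: LZ; exact: hX.
Qed.

Lemma nil_filtrationD j X Y : Nf j X -> Nf j Y -> Nf j (X + Y).
Proof. by have [_ h _] := nil_filtration_linear j; exact: h. Qed.

Lemma nil_filtrationZ j a X : Nf j X -> Nf j (a *: X).
Proof. by have [_ _ h] := nil_filtration_linear j; exact: h. Qed.

Lemma nil_filtration0 j : Nf j 0.
Proof. by have [h _ _] := nil_filtration_linear j. Qed.

Lemma nil_filtrationN j X : Nf j X -> Nf j (- X).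
Proof. by rewrite -scaleN1r; exact: nil_filtrationZ. Qed.

Lemma nil_filtrationB j X Y : Nf j X -> Nf j Y -> Nf j (X - Y).
Proof. by move=> hX /nil_filtrationN; exact: nil_filtrationD. Qed.

Lemma nil_filtration_sum j (I : Type) (r : seq I) (P : pred I) (X : I -> M) :
  (forall i, P i -> Nf j (X i)) -> Nf j (\sum_(i <- r | P i) X i).
Proof.
by move=> h; elim/big_ind: _ => //; [exact: nil_filtration0|exact: nil_filtrationD].
Qed.

Lemma nil_filtration_le i j : (i <= j)%N -> Nf j `<=` Nf i.
Proof.
move=> ij X [NX hX]; split => // k v /hX; apply: annihilated_le.
exact: leq_sub2l.
Qed.

Lemma nil_filtrationM i j X Y : Nf i X -> Nf j Y -> Nf (i + j) (X * Y).
Proof.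
move=> [NX hX] [NY hY]; split; first exact: NM.
by move=> k v /hY/hX; rewrite mulmxA addnC subnDA.
Qed.

Lemma nil_filtration1 X : N X -> Nf 1 X.
Proof.
by move=> NX; split => // k v Lv; rewrite subn1; exact: annihilatedM.
Qed.

Lemma nil_filtrationMS j X Y : (0 < j)%N -> Nf j X -> Nf j Y -> Nf j.+1 (X * Y).
Proof.
move=> j0 hX hY; apply: nil_filtration_le (nil_filtrationM hX hY).
by rewrite -addn1 leq_add2l.
Qed.

Lemma nil_filtrationX j X k : (0 < j)%N -> Nf j X -> Nf j.+1 (X ^+ k.+2).
Proof.
move=> j0 hX; suff h : Nf j (X ^+ k.+1).
  by rewrite exprSr; exact: nil_filtrationMS.
elim: k => // k ih; rewrite exprSr.
exact/(nil_filtration_le (leqnSn j))/nil_filtrationMS.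
Qed.

Lemma nil_filtration_eq0 : exists j, forall X, Nf j X -> X = 0.
Proof.
have [j full] := annihilated_full; exists j => X [_ hX].
apply/matrixP => a b; have := hX j (delta_mx b 0) (full _).
by rewrite subnn /= => /matrixP/(_ a 0); rewrite -colE !mxE.
Qed.

Lemma nil_filtration_conj j (S T : M) X : S * T = 1 -> T * S = 1 ->
  (forall Y, N Y -> N (S * Y * T)) -> (forall Y, N Y -> N (T * Y * S)) ->
  Nf j X -> Nf j (S * X * T).
Proof.
have inv (S' T' : M) : S' * T' = 1 -> (forall Y, N Y -> N (T' * Y * S')) ->
    forall k v, annihilated k v -> annihilated k (S' *m v).
  move=> ST hN; elim=> [v ->|k ih v Lv Y NY]; first by rewrite mulmx0.
  have -> : Y *m (S' *m v) = S' *m ((T' * Y * S') *m v).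
    by rewrite -!mulmxE !mulmxA; congr (_ *m v); rewrite !mulmxE ST mul1r.
  by apply: ih; apply: Lv; exact: hN.
move=> ST TS hS hT [NX hX]; split; first exact: hS.
move=> k v Lv; rewrite -!mulmxE -!mulmxA.
by apply: (inv S T) => //; apply: hX; exact: (inv T S).
Qed.

End NilAlgebra.

(** * Real powers of unipotent elements of a Zariski closed group *)

Section Roots.
Variables (R : realType) (n : nat).
Implicit Types (A : set (Aff R n)) (a b c : Aff R n) (x : 'M[R]_n.+1).

Definition binomial_poly (i : nat) : {poly R} :=
  i`!%:R^-1 *: \prod_(j < i) ('X - (j%:R)%:P).

Lemma binomial_poly_nat i k : (binomial_poly i).[k%:R] = 'C(k, i)%:R.
Proof.
have ff : (\prod_(j < i) ('X - (j%:R : R)%:P)).[k%:R] = (k ^_ i)%:R.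
  elim: i => [|i ih]; first by rewrite big_ord0 hornerE.
  rewrite big_ord_recr /= hornerM ih !hornerE ffactnSr natrM.
  case: (leqP i k) => ik; first by rewrite natrB.
  by rewrite ffact_small// !mul0r.
rewrite hornerZ ff -bin_ffact natrM mulrC mulfK//.
by rewrite pnatr_eq0 -lt0n fact_gt0.
Qed.

(** The binomial series for (1 + x)^t, truncated at order K; it is exact when
    x^K = 0. *)
Definition binomial_curve x (K : nat) (t : R) : 'M[R]_n.+1 :=
  \sum_(i < K) (binomial_poly i).[t] *: x ^+ i.

Lemma binomial_curve_nat x K k : x ^+ K = 0 ->
  binomial_curve x K k%:R = (1 + x) ^+ k.
Proof.
move=> xK; have x0 i : (K <= i)%N -> x ^+ i = 0.
  by move=> /subnK <-; rewrite exprD xK mulr0.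
rewrite addrC exprD1n /binomial_curve.
pose f i := 'C(k, i)%:R *: x ^+ i.
have -> : \sum_(i < K) (binomial_poly i).[k%:R] *: x ^+ i = \sum_(0 <= i < K) f i.
  by rewrite big_mkord; apply: eq_bigr => i _; rewrite binomial_poly_nat.
have -> : \sum_(i < k.+1) x ^+ i *+ 'C(k, i) = \sum_(0 <= i < k.+1) f i.
  by rewrite big_mkord; apply: eq_bigr => i _; rewrite /f scaler_nat.
have tail l m : (l <= m)%N -> (forall i, (l <= i)%N -> f i = 0) ->
    \sum_(0 <= i < l) f i = \sum_(0 <= i < m) f i.
  move=> lm f0; rewrite [RHS](big_cat_nat (n := l))//=.
  rewrite (big_nat_cond _ _ l m) [X in _ + X]big1 ?addr0// => i.
  by rewrite andbT => /andP[li _]; exact: f0.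
rewrite (tail K (maxn K k.+1)) ?leq_maxl//.
  rewrite (tail k.+1 (maxn K k.+1)) ?leq_maxr// => i ki.
  by rewrite /f bin_small// scale0r.
by move=> i Ki; rewrite /f x0// scaler0.
Qed.

Lemma unitmx_unipotent x K : x ^+ K = 0 -> 1 + x \in unitmx.
Proof.
move=> xK.
have : (1 + x) * (\sum_(i < K) (- x) ^+ i) = 1.
  have := subrX1 (- x) K; rewrite exprNn xK mulr0 sub0r.
  by rewrite -opprD mulNr => /oppr_inj; rewrite addrC => <-.
by rewrite -mulmxE => /mulmx1_unit[].
Qed.

Lemma binomial_curveE x K t : binomial_curve x K.+2 t =
  1 + t *: x + \sum_(i < K) (binomial_poly i.+2).[t] *: x ^+ i.+2.
Proof.
rewrite /binomial_curve !big_ord_recl /= addrA; congr (_ + _ + _).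
- by rewrite expr0 /binomial_poly big_ord0 hornerE /= invr1 mul1r hornerE scale1r.
- rewrite expr1 /binomial_poly big_ord_recl big_ord0 /= hornerZ mulr1.
  by rewrite !hornerE /= invr1 mul1r subr0.
Qed.

Lemma poly_eq0_nat (p : {poly R}) : (forall k : nat, p.[k%:R] = 0) -> p = 0.
Proof.
move=> h; apply/eqP/negPn/negP => p0.
have := @max_poly_roots R p [seq k%:R | k <- iota 0 (size p)] p0.
rewrite size_map size_iota ltnn => H; apply/notF/H.
  by apply/allP => _ /mapP[k _ ->]; rewrite rootE h.
by rewrite map_inj_uniq ?iota_uniq//; exact: mulrIn (oner_neq0 _).
Qed.

Lemma meval_curve N (q : 'I_N -> {poly R}) (p : mpoly.mpoly N R) :
  exists P : {poly R}, forall t, P.[t] = mpoly.meval (fun i => (q i).[t]) p.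
Proof.
exists (\sum_(m <- mpoly.msupp p)
  (mpoly.mcoeff m p)%:P * \prod_i q i ^+ mpoly.fun_of_multinom m i).
move=> t; rewrite mpoly.mevalE horner_sum; apply: eq_bigr => m _.
rewrite hornerM hornerC; congr (_ * _); rewrite horner_prod.
by apply: eq_bigr => i _; rewrite horner_exp.
Qed.

Lemma aff_coord_poly x K l : exists q : {poly R}, forall a t,
  hat a = binomial_curve x K t -> aff_coord a 0 l = q.[t].
Proof.
pose E (i j : 'I_n.+1) : {poly R} := \sum_(k < K) (x ^+ k) i j *: binomial_poly k.
have hE a t i j : hat a = binomial_curve x K t -> hat a i j = (E i j).[t].
  move=> ->; rewrite summxE horner_sum; apply: eq_bigr => k _.
  by rewrite mxE [RHS]hornerZ mulrC.
have hlin a i j : aff_lin a i j = hat a (@rshift 1 n i) (@rshift 1 n j).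
  exact/esym/(@block_mxEdr _ 1 n 1 n).
have htr a i : aff_trans a i 0 = hat a (@rshift 1 n i) (@lshift 1 n 0).
  exact/esym/(@block_mxEdl _ 1 n 1 n).
rewrite /aff_coord; case: (split_ordP l) => k ->.
  case/mxvec_indexP: k => i j; exists (E (@rshift 1 n i) (@rshift 1 n j)) => a t e.
  by rewrite row_mxEl mxvecE hlin; exact: hE.
exists (E (@rshift 1 n k) (@lshift 1 n 0)) => a t e.
by rewrite row_mxEr mxE htr; exact: hE.
Qed.

Lemma usubmx_first x : @usubmx _ 1 n _ x = 0 -> forall y, @usubmx _ 1 n _ (x * y) = 0.
Proof. by move=> x0 y; rewrite usubmxM x0 mul0mx. Qed.

Lemma usubmx_hat a : @usubmx _ 1 n _ (hat a) = @usubmx _ 1 n _ 1.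
Proof.
have -> : (1 : 'M[R]_n.+1) = block_mx (1%:M : 'M_1) 0 0 1%:M.
  exact: (@scalar_mx_block _ 1 n).
by rewrite /hat /block_mx !(@col_mxKu _ 1 n).
Qed.

Lemma hatX a k : hat (a ^+ k)%g = hat a ^+ k.
Proof. by elim: k => [|k ih]; rewrite ?expg0 ?hat1// expgS hatM ih exprS. Qed.

(** A polynomial equation of A, evaluated along the curve, is a polynomial in t
    that vanishes at every natural number, hence everywhere. *)
Lemma closed_unipotent_curve A a K : is_subgroup A -> zariski_closed A ->
    A a -> (hat a - 1) ^+ K = 0 ->
  forall t, exists2 b, A b & hat b = binomial_curve (hat a - 1) K t.
Proof.
move=> [A1 AM _] [P AP] Aa; set x := hat a - 1 => xK.
have x0 : @usubmx _ 1 n _ x = 0.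
  by rewrite /x raddfB /= usubmx_hat subrr.
have /choice[b hb] : forall t, exists b, hat b = binomial_curve x K t.
  move=> t; case: K xK => [|K] xK.
    by have /eqP := xK; rewrite expr0 oner_eq0.
  have eT : binomial_curve x K.+1 t =
      1 + x * \sum_(i < K) (binomial_poly i.+1).[t] *: x ^+ i.
    rewrite /binomial_curve big_ord_recl /=; congr (_ + _).
      by rewrite expr0 /binomial_poly big_ord0 hornerE /= invr1 mul1r hornerE scale1r.
    by rewrite mulr_sumr; apply: eq_bigr => i _; rewrite exprS -scalerAr.
  rewrite eT; set S := \sum_(i < K) _.
  have cS : GRing.comm x S.
    apply: commr_sum => i _.
    by rewrite /GRing.comm -scalerAl -scalerAr; congr (_ *: _); exact: commrX.
  have xSK : (x * S) ^+ K.+1 = 0 by rewrite exprMn_comm// xK mul0r.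
  apply: hat_ex; first exact: unitmx_unipotent xSK.
  by rewrite raddfD /= usubmx_first// addr0.
have [q hq] := choice (aff_coord_poly x K).
move=> t; exists (b t) => //; rewrite AP => p Pp.
have ev s : mpoly.meval (aff_coord (b s) 0) p = mpoly.meval (fun l => (q l).[s]) p.
  by apply: mpoly.meval_eq => l; exact: hq.
have [Q hQ] := meval_curve q p.
rewrite ev -hQ; suff -> : Q = 0 by rewrite horner0.
apply: poly_eq0_nat => k; rewrite hQ -ev.
have -> : b k%:R = (a ^+ k)%g.
  apply: hat_inj; rewrite hb binomial_curve_nat// hatX.
  by congr (_ ^+ _); rewrite /x addrC subrK.
have : A (a ^+ k)%g by elim: k => [|k ih]; rewrite ?expg0// expgS; exact: AM.
by rewrite AP; apply.
Qed.

Lemma commutant_linear G : linear_set (@commutant R n G).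
Proof.
split.
- by split=> [|g _]; rewrite ?raddf0 ?mul0r ?mulr0.
- move=> X Y [X0 cX] [Y0 cY]; split; first by rewrite raddfD /= X0 Y0 addr0.
  by move=> g Gg; rewrite mulrDl mulrDr cX// cY.
- move=> a X [X0 cX]; split; first by rewrite linearZ /= X0 scaler0.
  by move=> g Gg; rewrite -scalerAl cX// scalerAr.
Qed.

(** The element b is a^t. It is the same for all stages j of the filtration,
    and is taken here in a form that only records its first order term. *)
Lemma closed_unipotent_root A G a t : is_subgroup A -> zariski_closed A ->
    A a -> (exists K, (hat a - 1) ^+ K = 0) ->
  exists2 b, A b & forall j, (0 < j)%N ->
    nil_filtration (commutant G) j (hat a - 1) ->
    nil_filtration (commutant G) j.+1 (hat b - 1 - t *: (hat a - 1)).
Proof.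
move=> sA cA Aa [K xK].
have xK2 : (hat a - 1) ^+ K.+2 = 0 by rewrite -addn2 exprD xK mul0r.
have [b Ab hb] := closed_unipotent_curve sA cA Aa xK2 t.
exists b => // j j0 hx; rewrite hb binomial_curveE.
rewrite -[X in _ X]addrA -opprD addrAC subrr add0r.
apply: (nil_filtration_sum (commutant_linear G)) => i _.
apply: nil_filtrationZ; first exact: commutant_linear.
exact: (nil_filtrationX (@commutantM _ _ G)).
Qed.

End Roots.

(** * Trivializing the defect of a section *)

Section Approximation.
Variables (R : realType) (n : nat) (G : set (Aff R n)).
Implicit Types (a b s : Aff R n) (X Y : 'M[R]_n.+1).
Local Notation N := (commutant G).
Local Notation Nf := (nil_filtration (commutant G)).
Local Notation Nlin := (commutant_linear G).
Local Notation NM := (@commutantM R n G).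

Lemma commutant_hatP b :
  commutant G (hat b - 1) <-> forall g, G g -> (b * g = g * b)%g.
Proof.
split=> [[_ cb] g Gg|cb].
  apply: hat_inj; rewrite !hatM; have := cb g Gg.
  by rewrite mulrBl mulrBr mulr1 mul1r => /addIr.
split; first by rewrite raddfB /= usubmx_hat subrr.
by move=> g Gg; rewrite mulrBl mulrBr mulr1 mul1r -!hatM cb.
Qed.

Lemma commutant_hatV b : commutant G (hat b - 1) -> commutant G (hat b^-1%g - 1).
Proof.
move=> /commutant_hatP cb; apply/commutant_hatP => g Gg.
by apply: (mulgI b); rewrite mulVKg mulgA cb// mulgK.
Qed.

Definition normalizes s : Prop :=
  forall g, G g -> G (s * g * s^-1)%g /\ G (s^-1 * g * s)%g.

Lemma normalizesV s : normalizes s -> normalizes s^-1%g.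
Proof. by move=> h g /h[? ?]; rewrite invgK. Qed.

Lemma commutant_conj s Y : normalizes s -> N Y -> N (hat s * Y * hat s^-1%g).
Proof.
move=> ns [Y0 cY]; split.
  have sY0 : @usubmx _ 1 n _ (hat s * Y) = 0.
    by rewrite usubmxM usubmx_hat -usubmxM mul1r.
  by rewrite usubmxM sY0 mul0mx.
move=> g /[dup] Gg /ns[_ Gg'].
have e1 : hat s^-1%g * hat g = hat (s^-1 * g * s)%g * hat s^-1%g.
  by rewrite -!hatM mulgK.
have e2 : hat g * hat s = hat s * hat (s^-1 * g * s)%g.
  by rewrite -!hatM !mulgA mulgV mul1g.
by rewrite -[LHS]mulrA e1 !mulrA e2 -[in LHS](mulrA (hat s) Y) cY// !mulrA.
Qed.

Lemma nil_filtration_hat_conj j s X : normalizes s -> Nf j X ->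
  Nf j (hat s * X * hat s^-1%g).
Proof.
move=> ns; apply: nil_filtration_conj; rewrite ?hatKV ?hatVK//.
  by move=> Y; exact: commutant_conj.
move=> Y; have := commutant_conj (s := s^-1%g); rewrite invgK; apply.
exact: normalizesV.
Qed.

(** On the elements b with b - 1 in the j-th stage, b |-> b - 1 is a homomorphism
    to the additive group of that stage modulo the next one. The relation
    says that X represents the image of b; this replaces the quotient. *)
Definition approx (j : nat) b X := Nf j X /\ Nf j.+1 (hat b - 1 - X).

Lemma approx_refl j b : Nf j (hat b - 1) -> approx j b (hat b - 1).
Proof. by move=> h; split=> //; rewrite subrr; exact: (nil_filtration0 Nlin). Qed.

Lemma approx_mem j b X : approx j b X -> Nf j (hat b - 1).
Proof.
move=> [h1 /(nil_filtration_le (leqnSn j)) h2].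
by rewrite -(subrK X (hat b - 1)); exact: (nil_filtrationD Nlin).
Qed.

Lemma approx1 j : approx j 1%g 0.
Proof.
by rewrite /approx hat1 !subrr; split; exact: (nil_filtration0 Nlin).
Qed.

Lemma approxM j b X b' X' : (0 < j)%N -> approx j b X -> approx j b' X' ->
  approx j (b * b')%g (X + X').
Proof.
move=> j0 h h'; have [hX hb] := h; have [hX' hb'] := h'.
split; first exact: (nil_filtrationD Nlin).
have -> : hat (b * b')%g - 1 - (X + X') =
    (hat b - 1 - X) + (hat b' - 1 - X') + (hat b - 1) * (hat b' - 1).
  rewrite [RHS](_ : _ = hat b - 1 + (hat b' - 1) + (hat b - 1) * (hat b' - 1) - (X + X')).
    congr (_ - _); rewrite hatM mulrBr mulr1 mulrBl mul1r.
    by rewrite [RHS]addrC addrA subrK addrA subrK.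
  by rewrite [RHS]addrAC opprD [X in X + _ = _]addrACA.
apply: (nil_filtrationD Nlin); first exact: (nil_filtrationD Nlin).
exact: (nil_filtrationMS NM j0 (approx_mem h) (approx_mem h')).
Qed.

Lemma approxV j b X : (0 < j)%N -> approx j b X -> approx j b^-1%g (- X).
Proof.
move=> j0 h; have [hX hb] := h; split; first exact: (nil_filtrationN Nlin).
have -> : hat b^-1%g - 1 - - X =
    - (hat b - 1 - X) - (hat b^-1%g - 1) * (hat b - 1).
  rewrite mulrBr mulr1 mulrBl mul1r hatVK.
  rewrite -[1 - hat b]opprB; move: (hat b - 1) (hat b^-1%g - 1) => Y Z.
  by rewrite opprB (opprD (- Y)) !opprK addrA subrK addrC.
have hy := approx_mem h.
apply: (nil_filtrationB Nlin); first exact: (nil_filtrationN Nlin).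
rewrite -add1n; apply: (nil_filtrationM NM) => //.
by apply: nil_filtration1; apply: commutant_hatV; case: hy.
Qed.

Lemma approx_conj j s b X : normalizes s -> approx j b X ->
  approx j (s * b * s^-1)%g (hat s * X * hat s^-1%g).
Proof.
move=> ns [hX hb]; split; first exact: nil_filtration_hat_conj.
have -> : hat (s * b * s^-1)%g - 1 - hat s * X * hat s^-1%g =
    hat s * (hat b - 1 - X) * hat s^-1%g.
  by rewrite !mulrBr !mulrBl mulr1 hatKV !hatM.
exact: nil_filtration_hat_conj.
Qed.

Lemma approx_uniq j b X X' : approx j b X -> approx j b X' -> Nf j.+1 (X - X').
Proof.
move=> [_ h] [_ h'].
have -> : X - X' = (hat b - 1 - X') - (hat b - 1 - X).
  by rewrite opprB [RHS]addrC addrA subrK.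
exact: (nil_filtrationB Nlin).
Qed.

Lemma approx_step j b X : approx j b X -> Nf j.+1 X -> Nf j.+1 (hat b - 1).
Proof.
move=> [_ h] hX; rewrite -(subrK X (hat b - 1)).
exact: (nil_filtrationD Nlin).
Qed.

End Approximation.

Section Splitting.
Variables (R : realType) (n : nat) (A : set (Aff R n)).
Hypotheses (A_subgroup : is_subgroup A) (A_closed : zariski_closed A).
Variables (Gamma Delta : groupType) (i : Gamma -> Delta) (rho : Gamma -> Aff R n).
Hypothesis iM : {morph i : x y / (x * y)%g}.
Hypothesis i_normal : forall d g, exists g', i g' = (d * i g * d^-1)%g.
Variables (m : nat) (r : 'I_m -> Delta) (kappa : Delta -> 'I_m).
Hypotheses (kappa_coset : forall d, exists g, d = (r (kappa d) * i g)%g).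
Hypotheses (kappaM : forall d g, kappa (d * i g)%g = kappa d).
Hypotheses (kappa_r : forall k, kappa (r k) = k).
Local Notation G := (range rho).
Local Notation N := (commutant G).
Local Notation Nf := (nil_filtration (commutant G)).
Local Notation Nlin := (commutant_linear G).
Hypothesis Nnil : forall X, N X -> exists k, X ^+ k = 0.
Implicit Types s : Delta -> Aff R n.

(** Such an s is a homomorphism as far as Gamma is concerned: it restricts to rho
    up to the factor s 1, and conjugates rho as Delta conjugates Gamma. *)
Definition equivariant_section s : Prop :=
  [/\ forall d, A (s d),
      forall d g, s (d * i g)%g = (s d * rho g)%g &
      forall d g g', i g' = (d * i g * d^-1)%g -> (s d * rho g = rho g' * s d)%g].

Definition defect s d e : Aff R n := (s d * s e * (s (d * e))^-1)%g.

Definition defect_level (j : nat) s : Prop :=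
  forall d e, Nf j (hat (defect s d e) - 1).

Section OneSection.
Variable s : Delta -> Aff R n.
Hypothesis hs : equivariant_section s.

Lemma section_normalizes d : normalizes G (s d).
Proof.
have [_ _ hc] := hs; move=> _ [g _ <-]; split.
  have [g' eg'] := i_normal d g; exists g' => //.
  by rewrite (hc _ _ _ eg') mulgK.
have [g' eg'] := i_normal d^-1%g g; exists g' => //.
have e : i g = (d * i g' * d^-1)%g by rewrite eg' invgK !mulgA mulgV mul1g mulgK.
by apply: (mulgI (s d)); rewrite (hc _ _ _ e) !mulgA mulgV mul1g.
Qed.

Lemma defect_in d e : A (defect s d e).
Proof.
have [sA _ _] := hs; have [_ AM AV] := A_subgroup.
by apply: (AM); [apply: (AM)|apply: AV]; exact: sA.
Qed.

Lemma defect_commutant d e : N (hat (defect s d e) - 1).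
Proof.
have [_ _ hc] := hs; apply/commutant_hatP => _ [g _ <-].
have [g0 eg0] := i_normal (d * e)^-1%g g; rewrite invgK in eg0.
have [g1 eg1] := i_normal e g0.
have e2 : i g = (d * i g1 * d^-1)%g.
  by rewrite eg1 eg0 invgM !mulgA !mulgK mulgV mul1g.
have e3 : i g = ((d * e) * i g0 * (d * e)^-1)%g.
  by rewrite eg0 invgM !mulgA !mulgK mulgV mul1g.
have c3 : ((s (d * e))^-1 * rho g = rho g0 * (s (d * e))^-1)%g.
  apply: (mulgI (s (d * e)%g)); rewrite mulVKg mulgA (hc _ _ _ e3).
  by rewrite mulgK.
rewrite /defect -!mulgA c3 !mulgA; congr (_ * _)%g.
by rewrite -[LHS]mulgA (hc _ _ _ eg1) mulgA (hc _ _ _ e2) -!mulgA.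
Qed.

Lemma defect_right d e g : defect s d (e * i g)%g = defect s d e.
Proof.
have [_ hr _] := hs; rewrite /defect mulgA !hr invgM !mulgA.
by rewrite mulgK.
Qed.

(** With [defect_right], this makes the defect a cocycle of the finite quotient,
    so that it can be averaged. *)
Lemma defect_left d e g : defect s (d * i g)%g e = defect s d e.
Proof.
have [_ hr hc] := hs; have [g' eg'] := i_normal e^-1%g g; rewrite invgK in eg'.
have e1 : i g = (e * i g' * e^-1)%g by rewrite eg' !mulgA mulgV mul1g mulgK.
have -> : defect s (d * i g)%g e = (s d * s e * rho g' * (s (d * e * i g')%g)^-1)%g.
  rewrite /defect hr -(mulgA _ (rho g)) -(hc _ _ _ e1) mulgA; congr (_ * _^-1)%g.
  by congr s; rewrite e1 !mulgA mulgVK.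
by rewrite hr invgM !mulgA mulgK.
Qed.

Lemma defect_kappa d e : defect s d e = defect s d (r (kappa e)).
Proof. by have [g {1}->] := kappa_coset e; exact: defect_right. Qed.

Lemma defect_cocycle d e f : (defect s d e * defect s (d * e) f =
  s d * defect s e f * (s d)^-1 * defect s d (e * f))%g.
Proof. by rewrite /defect !mulgA !mulgVK. Qed.

Definition defect_sum d : 'M[R]_n.+1 := \sum_k (hat (defect s d (r k)) - 1).

(** Multiplication by e permutes the cosets. *)
Lemma defect_sum_shift d e :
  \sum_k (hat (defect s d (e * r k)%g) - 1) = defect_sum d.
Proof.
have inj : injective (fun k => kappa (e * r k)%g).
  move=> k l ekl; have [g eg] := kappa_coset (e * r k)%g.
  have [g' eg'] := kappa_coset (e * r l)%g.
  have i1 : i 1%g = 1%g by apply: (mulgI (i 1%g)); rewrite -iM !mulg1.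
  have iV x : i x^-1%g = (i x)^-1%g by apply: (mulgI (i x)); rewrite -iM !mulgV.
  rewrite -(kappa_r k) -(kappa_r l) -(kappaM (r l) (g'^-1 * g)).
  congr kappa; apply: (mulgI e).
  by rewrite eg ekl iM iV; set q := r _; rewrite !mulgA eg' mulgK.
rewrite /defect_sum [RHS](reindex_inj inj) /=.
by apply: eq_bigr => k _; rewrite -defect_kappa.
Qed.

(** Take the cocycle identity for (d, e, f) modulo the next stage, where it is
    linear, and sum it over representatives f of all cosets. *)
Lemma averaged_cocycle j d e : (0 < j)%N -> defect_level j s ->
  Nf j.+1 (m%:R *: (hat (defect s d e) - 1) + defect_sum (d * e) -
           (hat (s d) * defect_sum e * hat (s d)^-1%g + defect_sum d)).
Proof.
move=> j0 lv.
have -> : m%:R *: (hat (defect s d e) - 1) + defect_sum (d * e) -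
    (hat (s d) * defect_sum e * hat (s d)^-1%g + defect_sum d) =
  \sum_k (((hat (defect s d e) - 1) + (hat (defect s (d * e) (r k)) - 1)) -
    (hat (s d) * (hat (defect s e (r k)) - 1) * hat (s d)^-1%g +
     (hat (defect s d (e * r k)%g) - 1))).
  have sum4 (a : 'M[R]_n.+1) (x y z : 'I_m -> 'M[R]_n.+1) :
      \sum_k (a + x k - (y k + z k)) =
      m%:R *: a + \sum_k x k - (\sum_k y k + \sum_k z k).
    by rewrite sumrB !big_split /= sumr_const card_ord scaler_nat.
  rewrite [RHS]sum4 defect_sum_shift; congr (_ + _ - (_ + _)).
  by rewrite /defect_sum mulr_sumr mulr_suml.
apply: (nil_filtration_sum Nlin) => k _.
apply: (@approx_uniq _ _ _ _ (defect s d e * defect s (d * e) (r k))%g).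
  by apply: approxM => //; exact: approx_refl.
rewrite defect_cocycle; apply: approxM => //; last exact: approx_refl.
by apply: approx_conj; [exact: section_normalizes|exact: approx_refl].
Qed.

End OneSection.

(** By [averaged_cocycle], the defect of s is, modulo the next stage, the
    coboundary of (1/m) defect_sum. Multiplying s d by an
    element t d of A with t d - 1 = - (1/m) defect_sum d to first order removes
    it. Such a t d is the product over the cosets of the (-1/m)-th powers of the
    defects. *)
Lemma defect_level_step j s : (0 < j)%N -> equivariant_section s ->
  defect_level j s -> exists2 s', equivariant_section s' & defect_level j.+1 s'.
Proof.
move=> j0 hs lv; have [sA sr sc] := hs.
have [A1 AM AV] := A_subgroup.
have m0 : (0 < m)%N by case: m (kappa 1%g) => // -[].
have /choice[root hroot] : forall a, exists b, A a -> N (hat a - 1) -> A b /\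
    forall j, (0 < j)%N -> Nf j (hat a - 1) ->
      Nf j.+1 (hat b - 1 - (- m%:R^-1) *: (hat a - 1)).
  move=> a; have [Aa|] := pselect (A a); last by exists 1%g.
  have [Na|] := pselect (N (hat a - 1)); last by exists 1%g.
  have [b Ab hb] := closed_unipotent_root G (- m%:R^-1) A_subgroup A_closed
    Aa (Nnil Na).
  by exists b.
pose t d := \big[*%g/1%g]_(k < m) root (defect s d (r k)).
have tapprox d : A (t d) /\ approx G j (t d) (- m%:R^-1 *: defect_sum s d).
  rewrite /t /defect_sum scaler_sumr.
  apply: (big_ind2 (fun b X => A b /\ approx G j b X)).
  - by split=> //; exact: approx1.
  - by move=> b X b' X' [? ?] [? ?]; split; [exact: AM|exact: approxM].
  - move=> k _; have [Ab hb] :=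
      hroot _ (defect_in hs d (r k)) (defect_commutant hs d (r k)).
    split=> //; split; first exact/(nil_filtrationZ Nlin)/lv.
    exact/hb/lv.
have tcomm d g : (t d * rho g = rho g * t d)%g.
  have /commutant_hatP : N (hat (t d) - 1).
    by have [_ /approx_mem[]] := tapprox d.
  by apply; exists g.
exists (fun d => t d * s d)%g.
  split=> [d|d g|d g g' e].
  - by apply: AM => //; have [] := tapprox d.
  - rewrite sr mulgA; congr (_ * _ * _)%g.
    by apply: eq_bigr => k _; rewrite defect_left.
  - by rewrite -mulgA (sc _ _ _ e) mulgA tcomm -mulgA.
move=> d e.
have -> : defect (fun d => t d * s d)%g d e =
    (t d * (s d * t e * (s d)^-1) * defect s d e * (t (d * e))^-1)%g.
  by rewrite /defect invgM !mulgA !mulgVK.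
apply: approx_step.
  apply: approxM => //.
    2: by apply: approxV => //; have [_] := tapprox (d * e)%g; exact.
  apply: approxM => //; last exact/approx_refl/lv.
  apply: approxM => //; first by have [_] := tapprox d; exact.
  by apply: approx_conj; [exact: section_normalizes|have [_] := tapprox e; exact].
have mR : (m%:R : R) != 0 by rewrite pnatr_eq0 -lt0n.
have := nil_filtrationZ Nlin (m%:R^-1) (averaged_cocycle hs d e j0 lv).
congr (Nf _ _).
rewrite -!scalerAr -!scalerAl !scaleNr opprK.
move: (hat (defect s d e) - 1) (_ * _ * _) => Y Z.
rewrite scalerBr !scalerDr scalerA mulVf// scale1r opprD.
by rewrite [in LHS]addrC [in X in X + _ = _]addrC !addrA.
Qed.

Lemma splitting_section s : equivariant_section s ->
  exists2 s', equivariant_section s' & {morph s' : d e / (d * e)%g}.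
Proof.
move=> hs.
have lev j : exists2 s', equivariant_section s' & defect_level j.+1 s'.
  elim: j => [|j [s' hs' lv]]; last exact: defect_level_step lv.
  exists s => // d e; apply: nil_filtration1; exact: defect_commutant.
have [j hj] := nil_filtration_eq0 Nlin (@commutantM _ _ _) Nnil.
have [s' hs' lv] := lev j; exists s' => // d e.
have /hj/eqP := nil_filtration_le (leqnSn j) (lv d e).
rewrite subr_eq0 -(hat1 R n) => /eqP/hat_inj.
by move=> /(canRL (mulgK _)); rewrite mul1g invgK.
Qed.

End Splitting.

(** * Finite index and finite extensions *)

Section FiniteIndex.
Variables (R : realType) (n : nat).
Implicit Types (G H : set (Aff R n)).

Lemma metrically_proper_sub G H :
  H `<=` G -> metrically_proper G -> metrically_proper H.
Proof.
move=> HG mp B; apply: (sub_finite_set _ (mp B)) => g [/HG Gg hx].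
by split.
Qed.

Lemma cobounded_sub G H : H `<=` G -> cobounded H -> cobounded G.
Proof.
by move=> HG [B hB]; exists B => x; have [g /HG Gg gB] := hB x; exists g.
Qed.

Lemma aff_act_bounded_family m (t : 'I_m -> Aff R n) (B : R) :
  exists B' : R, forall k x, `|x| <= B -> `|aff_act (t k) x| <= B'.
Proof.
have [b hb] := choice (fun k => aff_act_bounded (t k) B).
exists (\sum_k `|b k|) => k x /hb/le_trans; apply.
by rewrite (bigD1 k)//= (le_trans (ler_norm _))// lerDl sumr_ge0.
Qed.

Lemma finite_index_cobounded m (t : 'I_m -> Aff R n) G H :
    (forall g, G g -> exists k, exists2 h, H h & g = (t k * h)%g) ->
  cobounded G -> cobounded H.
Proof.
move=> tGH [B hB]; have [B' hB'] := aff_act_bounded_family (fun k => (t k)^-1%g) B.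
exists B' => x; have [g /tGH[k [h Hh ->]] gB] := hB x; exists h => //.
have -> : aff_act h x = aff_act (t k)^-1%g (aff_act (t k * h)%g x).
  by rewrite -aff_actM mulKg.
exact: hB'.
Qed.

Lemma finite_index_metrically_proper m (t : 'I_m -> Aff R n) G H :
    (forall g, G g -> exists k, exists2 h, H h & g = (t k * h)%g) ->
  metrically_proper H -> metrically_proper G.
Proof.
move=> tGH mp B; have [B' hB'] := aff_act_bounded_family (fun k => (t k)^-1%g) B.
pose C := Num.max B B'.
pose S : set (Aff R n) := [set h | H h /\ exists2 x, `|x| <= C & `|aff_act h x| <= C].
have finS : finite_set S by exact: mp.
have fin : finite_set (\bigcup_(k in [set: 'I_m]) [set (t k * h)%g | h in S]).
  by apply: bigcup_finite => // k _; exact: finite_image.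
apply: (sub_finite_set _ fin) => g [/tGH[k [h Hh ->]] [x xB gxB]].
exists k => //; exists h => //; split=> //; exists x.
  by rewrite /C le_max xB.
have -> : aff_act h x = aff_act (t k)^-1%g (aff_act (t k * h)%g x).
  by rewrite -aff_actM mulKg.
by rewrite /C le_max hB'// orbT.
Qed.

End FiniteIndex.

Section Cosets.
Variables (D : groupType) (H : set D).
Hypothesis sH : is_subgroup H.

Lemma lcoset_id d : lcoset H d d.
Proof. by have [H1 _ _] := sH; exists 1%g => //; rewrite mulg1. Qed.

Lemma lcosetM d h : H h -> lcoset H (d * h)%g = lcoset H d.
Proof.
have [_ HM HV] := sH => Hh; apply/seteqP; split=> _ [h' Hh' <-].
  by exists (h * h')%g; [exact: HM|rewrite mulgA].
exists (h^-1 * h')%g; first by apply: HM => //; exact: HV.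
by rewrite mulgA mulgK.
Qed.

(** The representatives are indexed by an ordinal so that sums over the quotient
    can be reindexed; kappa d is the coset of d. *)
Lemma coset_representatives : finite_set (quotient_group H) ->
  exists (m : nat) (r : 'I_m -> D) (kappa : D -> 'I_m),
    [/\ forall d, exists2 h, H h & d = (r (kappa d) * h)%g,
        forall d h, H h -> kappa (d * h)%g = kappa d &
        forall k, kappa (r k) = k].
Proof.
move=> /finite_seqP[s0 es0]; pose s := undup s0.
have ms C : (C \in s) <-> quotient_group H C by rewrite es0 mem_undup.
have us : uniq s by exact: undup_uniq.
have ix d : (index (lcoset H d) s < size s)%N by rewrite index_mem; apply/ms; exists d.
have /choice[r hr] : forall k : 'I_(size s), exists d, lcoset H d = nth set0 s k.
  by move=> k; have /ms[d _ ed] := mem_nth set0 (ltn_ord k); exists d.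
exists (size s), r, (fun d => Ordinal (ix d)); split.
- move=> d; have : lcoset H (r (Ordinal (ix d))) d.
    by rewrite hr /= nth_index -?index_mem//; exact: lcoset_id.
  by move=> [h Hh e]; exists h.
- by move=> d h Hh; apply: val_inj; rewrite /= lcosetM.
- by move=> k; apply: val_inj; rewrite /= hr index_uniq.
Qed.

End Cosets.

Section ExtensionFacts.
Variables (Gamma Delta : groupType) (i : {multiplicative Gamma -> Delta}).
Hypothesis ext : effective_finite_extension i.

Lemma conjugation_automorphism d :
  exists phi : Aut Gamma, forall x, i (phi x) = (d * i x * d^-1)%g.
Proof.
have [iI [sN nN] _ _] := ext.
have ex e x : exists y, i y = (e * i x * e^-1)%g.
  have [|y _ ey] := nN (i x) e^-1%g _; first by exists x.
  by exists y; rewrite ey conjgE invgK mulgA.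
have [f hf] := choice (ex d); have [f' hf'] := choice (ex d^-1%g).
have fK : cancel f f'.
  by move=> x; apply: iI; rewrite hf' hf invgK !mulgA mulVg mul1g mulgVK.
have f'K : cancel f' f.
  by move=> x; apply: iI; rewrite hf hf' invgK !mulgA mulgV mul1g mulgK.
have fM : {morph f : x y / (x * y)%g}.
  by move=> x y; apply: iI; rewrite gmulfM !hf gmulfM !mulgA mulgVK.
by exists (MkAut fK f'K fM).
Qed.

(** An element centralizing Gamma has the same image in Out Gamma as 1. *)
Lemma centralizer_sub_range d : (forall x, d * i x = i x * d)%g -> range i d.
Proof.
have [iI [sN _] _ kI] := ext => cd.
have sub e : quotient_group (range i) (lcoset (range i) e) by exists e.
have e1 e : (forall x, e * i x = i x * e)%g ->
    abstract_kernel i (lcoset (range i) e) = lcoset (@Inn Gamma) 1%g.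
  by move=> ce; apply: abstract_kernel_lcoset => // x; rewrite ce mulgK.
have : lcoset (range i) d = lcoset (range i) 1%g.
  apply: kI; rewrite ?inE//; rewrite !e1//.
  by move=> x; rewrite mul1g mulg1.
move=> e; have := lcoset_id sN d; rewrite e => -[_ [x _ <-] <-].
by rewrite mul1g; exists x.
Qed.

End ExtensionFacts.

(** * Realizations and fixed points *)

Section Realization.
Variables (R : realType) (n : nat) (A : set (Aff R n)).
Hypotheses (A_subgroup : is_subgroup A).

Lemma conj_orbit_conj (Gamma : groupType) (rho : Gamma -> Aff R n) b : A b ->
  conj_orbit A (fun x => b * rho x * b^-1)%g = conj_orbit A rho.
Proof.
have [_ AM AV] := A_subgroup => Ab; apply/seteqP; split=> _ [a Aa <-].
  exists (a * b)%g; first exact: AM.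
  by apply/funext => x; rewrite invgM !mulgA.
exists (a * b^-1)%g; first by apply: AM => //; exact: AV.
by apply/funext => x; rewrite invgM invgK !mulgA !mulgVK.
Qed.

Lemma range_subgroup (Gamma : groupType) (rho : Gamma -> Aff R n) :
  {morph rho : x y / (x * y)%g} -> is_subgroup (range rho).
Proof.
move=> rhoM.
have rho1 : rho 1%g = 1%g by apply: (mulgI (rho 1%g)); rewrite -rhoM !mulg1.
split; first by exists 1%g.
- by move=> _ _ [x _ <-] [y _ <-]; exists (x * y)%g.
- move=> _ [x _ <-]; exists x^-1%g => //.
  by apply: (mulgI (rho x)); rewrite -rhoM !mulgV.
Qed.

Variables (Gamma Delta : groupType) (i : {multiplicative Gamma -> Delta}).
Hypothesis ext : effective_finite_extension i.

(** The restriction of a realization to Gamma is a fixed point: d acts on it as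
    conjugation by the inverse of sigma d. *)
Lemma realizable_fixed_point :
  realizable_as_crystallographic A Delta -> kernel_has_fixed_point A i.
Proof.
have [iI [sN nN] fin _] := ext.
have [m [r [kappa [kc _ _]]]] := coset_representatives sN fin.
move=> [G [cG GA] [sigma [sM [sG /(_ _ _ (mem_setT _) (mem_setT _)) sI sS]]]].
pose rho := sigma \o i.
have rhoM : {morph rho : x y / (x * y)%g} by move=> x y; rewrite /rho /= gmulfM sM.
have rhoG : range rho `<=` G by move=> _ [x _ <-]; exact: sG.
have /affine_crystallographicP[_ mp cb] := cG.
have cosets g : G g -> exists k, exists2 h, range rho h & g = (sigma (r k) * h)%g.
  move=> /sS[d _ <-]; have [_ [x _ <-] ed] := kc d.
  by exists (kappa d); exists (rho x); rewrite // -sM -ed.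
have hrho : Hom_c A rho.
  split=> //; first by move=> x y /sI/iI.
    by move=> y /rhoG/GA.
  apply/affine_crystallographicP; split; first exact: range_subgroup.
    exact: metrically_proper_sub mp.
  exact: finite_index_cobounded cosets cb.
exists (conj_orbit A rho); first by exists rho.
move=> _ [d _ <-]; have [phi hphi] := conjugation_automorphism ext d.
rewrite (abstract_kernel_lcoset iI hphi) out_act_lcoset//.
have [_ _ AV] := A_subgroup.
rewrite -(@conj_orbit_conj _ rho (sigma d)^-1%g); last exact/AV/GA/sG.
congr conj_orbit; apply/funext => x; rewrite /aut_act /rho /= invgK.
apply: (mulgI (sigma d)); rewrite !mulgA mulgV mul1g -!sM; congr sigma.
have e : x = phi (phi^-1%g x) by rewrite -[RHS]/((phi * phi^-1)%g x) mulgV.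
by rewrite [in RHS]e hphi mulgVK.
Qed.

Hypothesis A_closed : zariski_closed A.

(** The fixed point gives an equivariant section s, defined on representatives
    of the cosets first; [splitting_section] turns it into a homomorphism. *)
Lemma fixed_point_realizable :
  kernel_has_fixed_point A i -> realizable_as_crystallographic A Delta.
Proof.
have [iI [sN nN] fin _] := ext.
have iM : {morph i : x y / (x * y)%g} by exact: gmulfM.
have [m [r [kappa [kc kM kr]]]] := coset_representatives sN fin.
move=> [_ [rho [rhoM rhoI rhoA crho] <-] fixed].
have [A1 AM AV] := A_subgroup.
have /affine_crystallographicP[_ mp cb] := crho.
have /choice[a ha] : forall d, exists a, A a /\ forall g g',
    i g' = (d * i g * d^-1)%g -> (a * rho g = rho g' * a)%g.
  move=> d; have [phi hphi] := conjugation_automorphism ext d.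
  have : conj_orbit A rho (aut_act phi rho).
    rewrite -(fixed (lcoset (range i) d)); last by exists d.
    exists phi; first by exists d => //; exact: lcoset_id.
    exists rho => //; exists 1%g => //.
    by apply/funext => x; rewrite mul1g invg1 mulg1.
  move=> [b Ab eb]; exists b^-1%g; split; first exact: AV.
  move=> g g' eg; have -> : g' = phi g by apply: iI; rewrite eg hphi.
  apply: (mulgI b); rewrite mulVKg.
  have <- : aut_act phi rho (phi g) = rho g by congr rho; exact: (aut_funK phi).
  by rewrite -eb !mulgA.
have /choice[h hh] : forall d, exists g, d = (r (kappa d) * i g)%g.
  by move=> d; have [_ [g _ <-] ed] := kc d; exists g.
pose s d := (a (r (kappa d)) * rho (h d))%g.
have ks d g : kappa (d * i g)%g = kappa d by apply: kM; exists g.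
have hs : equivariant_section A i rho s.
  split=> [d|d g|d g g' eg].
  - by apply: AM; [exact: (ha _).1|apply: rhoA; exists (h d)].
  - rewrite /s ks -mulgA -rhoM; congr (_ * rho _)%g.
    apply: iI; rewrite iM; apply: (mulgI (r (kappa d))).
    by rewrite mulgA -hh -{1}(ks d g) -hh.
  - rewrite /s -mulgA -rhoM.
    have -> : (h d * g = h d * g * (h d)^-1 * h d)%g by rewrite mulgVK.
    rewrite rhoM !mulgA; congr (_ * _)%g; apply: (ha _).2.
    rewrite eg {1 2}(hh d) invgM !mulgA !iM.
    have iV x : i x^-1%g = (i x)^-1%g.
      apply: (mulgI (i x)); rewrite -iM !mulgV.
      by apply: (mulgI (i 1%g)); rewrite -iM !mulg1.
    by rewrite iV !mulgA.
have inormal d g : exists g', i g' = (d * i g * d^-1)%g.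
  by have [phi hphi] := conjugation_automorphism ext d; exists (phi g).
have cosets d : exists g, d = (r (kappa d) * i g)%g by exists (h d).
have Nnil X := @commutant_nilpotent R n (range rho) X mp cb.
have [s' [sA' sr' sc'] sM'] :=
  splitting_section A_subgroup A_closed iM inormal cosets ks kr Nnil hs.
have s1 : s' 1%g = 1%g by apply: (mulgI (s' 1%g)); rewrite -sM' !mulg1.
have si g : s' (i g) = rho g by rewrite -[i g]mul1g sr' s1 mul1g.
have sI : injective s'.
  have ker d : s' d = 1%g -> d = 1%g.
    move=> sd; have [x|g _ eg] := @centralizer_sub_range _ _ i ext d.
      have [x' ex'] := inormal d x.
      have := sc' _ _ _ ex'; rewrite sd mul1g mulg1 => /rhoI e.
      by rewrite -e in ex'; rewrite [in RHS]ex' mulgVK.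
    move: sd; rewrite -eg si => rg.
    have rho1 : rho 1%g = 1%g by apply: (mulgI (rho 1%g)); rewrite -rhoM !mulg1.
    have -> : g = 1%g by apply: rhoI; rewrite rg.
    by apply: (mulgI (i 1%g)); rewrite -iM !mulg1.
  move=> d e sde; apply: (mulIg e^-1%g); rewrite mulgV; apply: ker.
  by rewrite sM' sde -sM' mulgV.
have subr : range rho `<=` range s' by move=> _ [g _ <-]; exists (i g).
have cosets' g : range s' g -> exists k, exists2 b, range rho b & g = (s' (r k) * b)%g.
  move=> [d _ <-]; exists (kappa d), (rho (h d)); first by exists (h d).
  by rewrite -sr' -hh.
exists (range s').
  split; last by move=> _ [d _ <-].
  apply/affine_crystallographicP; split; first exact: range_subgroup.
    exact: finite_index_metrically_proper cosets' mp.
  exact: cobounded_sub subr cb.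
exists s'; split=> //; split.
- by move=> d _; exists d.
- by move=> d e _ _; exact: sI.
- by move=> _ [d _ <-]; exists d.
Qed.

End Realization.

Theorem theorem3p10 (R : realType) (n : nat) (A : set (Aff R n))
    (Gamma Delta : groupType) (i : {multiplicative Gamma -> Delta})
    (A_subgroup : is_subgroup A) (A_closed : zariski_closed A)
    (A_transitive : acts_transitively A)
    (Gamma_fg : finitely_generated Gamma) (Gamma_tf : torsionfree Gamma)
    (Gamma_nil : is_nilpotent Gamma)
    (Gamma_real : realizable_as_crystallographic A Gamma)
    (Delta_ext : effective_finite_extension i) :
  realizable_as_crystallographic A Delta <-> kernel_has_fixed_point A i.
Proof.
split; first exact: realizable_fixed_point.
exact: fixed_point_realizable.
Qed.
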